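(* For all $n\ge1$ and $\varepsilon\in(0,1)$, one has $P(n,\varepsilon)\le 2^n(1+\log 1/\varepsilon)^n$.
   Context: A parallelepiped is the image of the cube $[-1,1]^n$ under an affine map $x\mapsto Ex+d$ with $E$ non-singular; scaling it by $2$ from its center of gravity $d$ gives the image of $[-2,2]^n$ under the same map. Let $H=[-1,1]^n$ and $H_\varepsilon=[-1+\varepsilon,1-\varepsilon]^n$. $P(n,\varepsilon)$ denotes the smallest number of parallelepipeds whose union covers $H_\varepsilon$ and each of which, when scaled by $2$ from its center of gravity, is contained in $H$. Logarithms are base 2. *)

(* Defs.v *)
From HB Require Import structures.
From mathcomp Require Import all_boot all_order all_algebra.
From mathcomp Require Import classical_sets reals exp.
Set Implicit Arguments.
Unset Strict Implicit.
Unset Printing Implicit Defensive.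
Import Order.TTheory GRing.Theory Num.Theory.
Local Open Scope classical_set_scope.
Local Open Scope ring_scope.

Definition log2 (R : realType) (x : R) : R := ln x / ln 2.

Definition cube (R : realType) (n : nat) (r : R) : set 'cV[R]_n :=
  [set x | forall i, - r <= x i 0 <= r].
Arguments cube {R} n r.

(* Data (E, d) presenting the parallelepiped E [-1, 1]^n + d. *)
Record parallelepiped (R : realType) (n : nat) := Parallelepiped {
  pmat : 'M[R]_n;
  pcenter : 'cV[R]_n;
  pmat_unit : pmat \in unitmx
}.

Definition pset (R : realType) (n : nat) (P : parallelepiped R n) :
    set 'cV[R]_n :=
  [set pmat P *m x + pcenter P | x in cube n 1].

Definition pscale (R : realType) (n : nat) (t : R) (P : parallelepiped R n) :
    set 'cV[R]_n :=
  [set pcenter P + t *: (y - pcenter P) | y in pset P].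

Definition coverable (R : realType) (n : nat) (eps : R) (m : nat) : Prop :=
  exists F : 'I_m -> parallelepiped R n,
    cube n (1 - eps) `<=` \bigcup_k pset (F k) /\
    forall k, pscale 2 (F k) `<=` cube n 1.
Arguments coverable {R} n eps m.

(* The relation "P(n, eps) = m". A family indexed by 'I_m may repeat a
   parallelepiped, which does not affect the minimum. *)
Definition is_P (R : realType) (n : nat) (eps : R) (m : nat) : Prop :=
  coverable n eps m /\ forall k, coverable n eps k -> (m <= k)%N.
Arguments is_P {R} n eps m.

(* Main.v *)
Require Import Defs.
From HB Require Import structures.
From mathcomp Require Import all_boot all_order all_algebra.
From mathcomp Require Import boolp classical_sets reals exp.
From mathcomp Require Import lra.
Import Order.TTheory GRing.Theory Num.Theory.
Local Open Scope ring_scope.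

(** It suffices to cover the segment [[-1 + eps, 1 - eps]] by at most
    [2 (1 + log2 (1 / eps))] segments whose doubles lie in [[-1, 1]], and to take
    all products of [n] such segments.  A segment on which the distance to the
    endpoint [1] ranges over the dyadic interval [[2^-(k+1), 2^-k]] has this
    property, and so has its mirror image; the values
    [k = 0, ..., floor (log2 (1 / eps))] exhaust all distances from [eps] to
    [1]. *)

(** Segment [i] has center [c i] and half-length [r i]. Each choice [f] of one segment per
    coordinate gives a box, with diagonal matrix; a point lies in the box obtained by choosing a
    segment for each of its coordinates. *)
Lemma coverable_prod (R : realType) (n : nat) (eps : R) (I : finType)
    (c r : I -> R) :
  (forall i, 0 < r i) ->
  (forall i, -1 <= c i - 2 * r i) -> (forall i, c i + 2 * r i <= 1) ->
  (forall x : R, - (1 - eps) <= x <= 1 - eps ->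
     exists i, c i - r i <= x <= c i + r i) ->
  coverable n eps (#|I| ^ n)%N.
Proof.
move=> r_gt0 lo hi cov.
pose D (f : {ffun 'I_n -> I}) : 'M[R]_n := diag_mx (\row_j r (f j)).
have Dunit f : D f \in unitmx.
  rewrite unitmxE det_diag unitfE; apply/prodf_neq0 => i _.
  by rewrite mxE gt_eqF.
have DE f (y : 'cV[R]_n) i : (D f *m y) i 0 = r (f i) * y i 0.
  by rewrite mul_diag_mx !mxE.
pose B (f : {ffun 'I_n -> I}) := Parallelepiped (\col_j c (f j)) (Dunit f).
have <- : #|{ffun 'I_n -> I}| = (#|I| ^ n)%N by rewrite card_ffun card_ord.
exists (fun k => B (enum_val k)); split => [x xcube|k _ [_ [y ycube <-] <-] i].
  have [f fP] : exists f : {ffun 'I_n -> I},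
      forall i, c (f i) - r (f i) <= x i 0 <= c (f i) + r (f i).
    have [g gP] := choice (fun i => cov _ (xcube i)).
    by exists (finfun g) => i; rewrite ffunE.
  exists (enum_rank f) => //=; rewrite enum_rankK.
  exists (\col_i ((x i 0 - c (f i)) / r (f i))) => [i|].
    rewrite mxE ler_pdivlMr // ler_pdivrMr //.
    by have := fP i; lra.
  apply/colP => i; rewrite mxE /= DE !mxE mulrC divfK ?gt_eqF //.
  by rewrite subrK.
rewrite /= addrK 3!mxE DE; set f := enum_val k.
have := ycube i; have := lo (f i); have := hi (f i); have := r_gt0 (f i).
by move=> r0 h l /andP[y1 y2]; apply/andP; split; nra.
Qed.

Lemma dyadic_interval (R : realFieldType) (K : nat) (u : R) :
  2^-1 ^+ K < u <= 1 ->
  exists k : 'I_K, 2^-1 ^+ k / 2 <= u <= 2^-1 ^+ k.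
Proof.
(* For [K = 0] the hypothesis is contradictory, thanks to the strict lower bound. *)
elim: K => [|K IHK] /andP[Ku u1]; first by move: Ku; rewrite expr0 ltNge u1.
have [uK|uK] := leP u (2^-1 ^+ K).
  by exists ord_max; rewrite uK -exprSr ltW.
have [k kP] := IHK (introT andP (conj uK u1)).
by exists (widen_ord (leqnSn K) k).
Qed.

Lemma coverable_dyadic (R : realType) (n K : nat) (eps : R) :
  2^-1 ^+ K < eps -> coverable n eps ((2 * K) ^ n)%N.
Proof.
move=> Keps.
pose w (i : bool * 'I_K) : R := 2^-1 ^+ i.2.
have w01 i : 0 < w i <= 1.
  by rewrite exprn_gt0 ?invr_gt0 //= exprn_ile1 ?invr_ge0 // invf_le1 ?ler1n.
(* Distances to the endpoint in [[w/2, w]] have midpoint [3w/4] and half-length [w/4]. Doubling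
   extends them to [[w/4, 5w/4]], within [[0, 2]] as [w <= 1]. The boolean selects the endpoint. *)
pose c (i : bool * 'I_K) : R := (-1) ^+ i.1 * (1 - 3 / 4 * w i).
have <- : #|{: bool * 'I_K}| = (2 * K)%N.
  by rewrite card_prod card_bool card_ord.
apply: (@coverable_prod _ _ _ _ c (fun i => w i / 4)) => [i|i|i|x xP].
- by have := w01 i; lra.
- by have := w01 i; rewrite /c; case: i.1; rewrite ?expr0 ?expr1; lra.
- by have := w01 i; rewrite /c; case: i.1; rewrite ?expr0 ?expr1; lra.
(* The nearer endpoint is used, so that the distance is at most 1. *)
have [x0|x0] := leP 0 x.
  have [|k] := @dyadic_interval R K (1 - x); first by apply/andP; split; lra.
  by exists (false, k); rewrite /c /w /= expr0; lra.
have [|k] := @dyadic_interval R K (1 + x); first by apply/andP; split; lra.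
by exists (true, k); rewrite /c /w /= expr1; lra.
Qed.

Lemma exp2_truncn_log2_lt (R : realType) (eps : R) : 0 < eps < 1 ->
  2^-1 ^+ (Num.truncn (log2 (1 / eps))).+1 < eps.
Proof.
move=> /andP[e0 e1]; set L := log2 _.
have ln2 : 0 < ln (2 : R) by rewrite ln_gt0 // ltr1n.
have e1V : 0 < 1 / eps by rewrite divr_gt0.
have : L < (Num.truncn L).+1%:R by exact: truncnS_gt.
rewrite {1}/L /log2 ltr_pdivrMr // mulr_natl -lnXn //.
rewrite ltr_ln ?posrE ?exprn_gt0 // div1r exprVn => lt_eps.
by rewrite -[ltRHS]invrK ltf_pV2 // posrE ?exprn_gt0 ?invr_gt0.
Qed.

Theorem theorem2p6 (R : realType) (n : nat) (eps : R)
  (hn : (1 <= n)%N) (heps : 0 < eps < 1) :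
  exists m : nat,
    is_P n eps m /\ m%:R <= 2 ^+ n * (1 + log2 (1 / eps)) ^+ n :> R.
Proof.
set L := log2 (1 / eps).
have cov := @coverable_dyadic R n _ eps (exp2_truncn_log2_lt _ _ heps).
(* A finite cover exists, so a least size does too; the boolean reflection allows [ex_minnP]. *)
have ex : exists m, `[< coverable n eps m >] by eexists; apply/asboolP; exact: cov.
case: (ex_minnP ex) => m /asboolP mcov mmin; exists m; split.
  by split=> // k /asboolP; exact: mmin.
have L0 : 0 <= L.
  have /andP[e0 e1] := heps.
  rewrite /L /log2 divr_ge0 ?ln_ge0 ?ler1n // div1r invf_ge1 //.
  exact: ltW.
have m_le : (m <= (2 * (Num.truncn L).+1) ^ n)%N by apply/mmin/asboolP.
apply: (@le_trans _ _ ((2 * (Num.truncn L).+1) ^ n)%:R); first by rewrite ler_nat.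
(* It remains to compare [n]-th powers, where the truncation of [L] is at most [L] because
   [0 <= L]. *)
rewrite natrX natrM exprMn ler_pM2l ?exprn_gt0 //.
rewrite lerXn2r ?nnegrE ?addr_ge0 // -natr1 addrC lerD2l.
by rewrite truncn_le.
Qed.
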